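(* Let $(\Omega,\mathcal F,\mu)$ be a $\sigma$-finite measure space, let $X$ be an order continuous Banach function space over $(\Omega,\mathcal F,\mu)$, and let $(y_\alpha)$ be a net in $L_0(\mu)$. Then $(y_\alpha)$ un-converges to $0$ in $L_0(\mu)$ with respect to $X$ if and only if, for every $A\in\mathcal F$ with $\mu(A)<\infty$, the net of restrictions $(y_{\alpha}|_{A})$ converges to zero in measure.
   Context: $L_0(\mu)$ is the vector lattice of all (real-valued) $\mu$-measurable functions, with functions that are equal a.e. identified. A Banach function space over $(\Omega,\mathcal F,\mu)$ is a Banach lattice $X$ which is an order dense ideal in $L_0(\mu)$. An ideal $X$ of a vector lattice $Y$ is a linear subspace such that $|y|\le|x|$, $x\in X$, $y\in Y$ imply $y\in X$; a sublattice $X$ of $Y$ is order dense if for every non-zero $y\in Y_+$ there is $x\in X$ with $0<x\le y$. $X$ is order continuous if $x_\alpha\downarrow 0$ in $X$ implies $\|x_\alpha\|\to 0$. A net $(y_\alpha)$ in $Y$ un-converges to $y\in Y$ with respect to a normed lattice $X$ that is an ideal in $Y$ if $\bigl\||y_\alpha-y|\wedge x\bigr\|_X\to 0$ for every $x\in X_+$. For $A\in\mathcal F$ and $y\in L_0(\mu)$, $y|_A$ denotes the restriction of $y$ to $A$, identified with $y\cdot\chi_A$. *)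

(* Defs.v *)
From HB Require Import structures.
From mathcomp Require Import all_boot all_order all_algebra.
From mathcomp Require Import all_classical all_reals all_analysis.
From mathcomp Require Import measurable_realfun.

Set Implicit Arguments.
Unset Strict Implicit.
Unset Printing Implicit Defensive.

Import Order.TTheory GRing.Theory Num.Theory.
Import numFieldNormedType.Exports.

Local Open Scope classical_set_scope.
Local Open Scope ring_scope.

(* [Order.Lattice] cannot be joined with [GRing.Lmodule] at [ring_display] (a
   missing join with [Num.RealDomain]), so that the lattice operations of the
   order are part of the mixin. *)
HB.mixin Record isVectorLattice (R : realType) V
    & GRing.Lmodule R V & Num.POrderedZmodule V := {
  vmeet : V -> V -> V ;
  vjoin : V -> V -> V ;
  vmeetP : forall x y z : V, (x <= vmeet y z) = (x <= y) && (x <= z) ;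
  vjoinP : forall x y z : V, (vjoin x y <= z) = (x <= z) && (y <= z) ;
  vlat_leD2r : forall x y z : V, x <= y -> x + z <= y + z ;
  vlat_scale_ge0 : forall (a : R) (x : V), 0 <= a -> 0 <= x -> 0 <= a *: x
}.

#[short(type="vectorLatticeType")]
HB.structure Definition VectorLattice (R : realType) :=
  {V of GRing.Lmodule R V & Num.POrderedZmodule V & isVectorLattice R V}.

Definition vabs (R : realType) (Y : vectorLatticeType R) (x : Y) : Y :=
  vjoin x (- x).

Definition ideal (R : realType) (Y : vectorLatticeType R) (P : pred Y) : Prop :=
  [/\ P 0,
      forall (a : R) (x y : Y), P x -> P y -> P (a *: x + y) &
      forall x y : Y, P x -> vabs y <= vabs x -> P y].

Definition order_dense (R : realType) (Y : vectorLatticeType R) (P : pred Y) :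
    Prop :=
  forall y : Y, 0 < y -> exists x : Y, [/\ P x, 0 < x & x <= y].

Definition directed d (I : preorderType d) : Prop :=
  inhabited I /\ forall i j : I, exists k : I, (i <= k)%O /\ (j <= k)%O.

Definition net_filter d (I : preorderType d) : set_system I :=
  filter_from [set: I] (fun i => [set j | (i <= j)%O]).

Arguments net_filter {d} I.

Lemma net_filter_proper d (I : preorderType d) :
  directed I -> ProperFilter (net_filter I).
Proof.
move=> [[i0] dirI]; apply: filter_from_proper; last by move=> i _; exists i => /=.
apply: filter_fromT_filter; first by exists i0.
move=> i j; have [k [ik jk]] := dirI i j; exists k => l /= kl.
by split; [exact: le_trans ik kl|exact: le_trans jk kl].
Qed.

(* [X] is the subtype of [Y] cut out by [P]; its linear structure is inherited
   from [Y] through [val], while its complete norm is its own. *)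
#[short(type="banachSubspaceType")]
HB.structure Definition BanachSubspace (R : realType) (Y : lmodType R)
    (P : pred Y) :=
  {X of @GRing.SubLmodule R Y P X & CompleteNormedModule R X}.

Section banach_lattice.
Context (R : realType) (Y : vectorLatticeType R) (P : pred Y).
Variable X : banachSubspaceType P.

Definition lattice_norm : Prop :=
  forall x y : X, vabs (val x) <= vabs (val y) -> `|x| <= `|y|.

Definition decreases_to0 d (I : preorderType d) (x : I -> X) : Prop :=
  [/\ forall i j : I, (i <= j)%O -> val (x j) <= val (x i),
      forall i : I, 0 <= val (x i) &
      forall z : X, (forall i : I, val z <= val (x i)) -> val z <= 0].

Definition order_continuous : Prop :=
  forall d (I : preorderType d) (x : I -> X), directed I ->
    decreases_to0 x -> `|x i| @[i --> net_filter I] --> (0 : R).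

(* When [P] is an ideal the element of [Y] fed to [insubd] satisfies [P], so
   the default value [0] is never used. *)
Definition un_cvg d (I : preorderType d) (y : I -> Y) (l : Y) : Prop :=
  forall x : X, 0 <= val x ->
    `|insubd (0 : X) (vmeet (vabs (y i - l)) (val x))| @[i --> net_filter I]
      --> (0 : R).

End banach_lattice.

Definition L0 d (T : measurableType d) (R : realType)
  (mu : {measure set T -> \bar R}) : Type := {mfun_ mu, T >-> R}.

Section L0_vector_lattice.
Context d (T : measurableType d) (R : realType).
Variable mu : {measure set T -> \bar R}.
Local Notation L0 := (L0 mu).
Implicit Types (f g : {mfun T >-> R}) (x y z : L0) (a : R).

HB.instance Definition _ := Choice.on L0.
HB.instance Definition _ := EqQuotient.on L0.

Local Open Scope quotient_scope.

Definition L0_class f : L0 := \pi_L0 f.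

Definition L0_fun x : {mfun T >-> R} := repr x.

Lemma L0_classP f g : L0_class f = L0_class g <-> \forall t \ae mu, f t = g t.
Proof.
split=> [/eqP|fg]; last first.
  by apply/eqP; rewrite /L0_class eqmodE; apply/asboolP; apply: filterS fg.
rewrite /L0_class eqmodE => /asboolP; apply: filterS => t; exact.
Qed.

Lemma L0_funK x : L0_class (L0_fun x) = x.
Proof. exact: reprK. Qed.

Lemma L0_classK f : \forall t \ae mu, L0_fun (L0_class f) t = f t.
Proof. by apply/L0_classP; rewrite L0_funK. Qed.

Lemma L0W (Q : L0 -> Prop) : (forall f, Q (L0_class f)) -> forall x, Q x.
Proof. by move=> Qf x; rewrite -(L0_funK x). Qed.

Definition L0_zero : L0 := L0_class 0.
Definition L0_opp x : L0 := L0_class (- L0_fun x).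
Definition L0_add x y : L0 := L0_class (L0_fun x + L0_fun y).
Definition L0_scale a x : L0 := L0_class (a *: L0_fun x).
Definition L0_le x y : bool :=
  `[< \forall t \ae mu, L0_fun x t <= L0_fun y t >].
Definition L0_lt x y : bool := (y != x) && L0_le x y.
Definition L0_meet x y : L0 := L0_class (min_mfun (L0_fun x) (L0_fun y)).
Definition L0_join x y : L0 := L0_class (max_mfun (L0_fun x) (L0_fun y)).

Lemma L0_oppE f : L0_opp (L0_class f) = L0_class (- f).
Proof.
by apply/L0_classP; have := L0_classK f; apply: filterS => t; exact: congr1.
Qed.

Lemma L0_addE f g : L0_add (L0_class f) (L0_class g) = L0_class (f + g).
Proof.
apply/L0_classP; have := L0_classK g; have := L0_classK f.
by apply: filterS2 => t; exact: (congr2 +%R).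
Qed.

Lemma L0_scaleE a f : L0_scale a (L0_class f) = L0_class (a *: f).
Proof.
by apply/L0_classP; have := L0_classK f; apply: filterS => t; exact: (congr1 ( *%R a)).
Qed.

Lemma L0_leP f g :
  L0_le (L0_class f) (L0_class g) <-> \forall t \ae mu, f t <= g t.
Proof.
split=> [/asboolP|] fg.
- have := L0_classK g; have := L0_classK f; move: fg.
  by apply: filterS3 => t /= + <- <-.
- apply/asboolP; have := L0_classK g; have := L0_classK f; move: fg.
  by apply: filterS3 => t /= + -> ->.
Qed.

Lemma L0_meetE f g :
  L0_meet (L0_class f) (L0_class g) = L0_class (min_mfun f g).
Proof.
apply/L0_classP; have := L0_classK g; have := L0_classK f.
by apply: filterS2 => t; exact: (congr2 Num.min).
Qed.

Lemma L0_joinE f g :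
  L0_join (L0_class f) (L0_class g) = L0_class (max_mfun f g).
Proof.
apply/L0_classP; have := L0_classK g; have := L0_classK f.
by apply: filterS2 => t; exact: (congr2 Num.max).
Qed.

Let addA : associative L0_add.
Proof.
elim/L0W => f; elim/L0W => g; elim/L0W => h.
by rewrite !L0_addE addrA.
Qed.

Let addC : commutative L0_add.
Proof. by elim/L0W => f; elim/L0W => g; rewrite !L0_addE addrC. Qed.

Let add0 : left_id L0_zero L0_add.
Proof. by elim/L0W => f; rewrite L0_addE add0r. Qed.

Let addN : left_inverse L0_zero L0_opp L0_add.
Proof. by elim/L0W => f; rewrite L0_oppE L0_addE addNr. Qed.

HB.instance Definition _ := GRing.isZmodule.Build L0 addA addC add0 addN.

Let scaleA a b x : L0_scale a (L0_scale b x) = L0_scale (a * b) x.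
Proof. by elim/L0W: x => f; rewrite !L0_scaleE scalerA. Qed.

Let scale1 : left_id 1 L0_scale.
Proof. by elim/L0W => f; rewrite L0_scaleE scale1r. Qed.

Let scaleDr : right_distributive L0_scale L0_add.
Proof.
move=> a; elim/L0W => f; elim/L0W => g.
by rewrite L0_addE !L0_scaleE L0_addE scalerDr.
Qed.

Let scaleDl x : {morph L0_scale^~ x : a b / a + b >-> L0_add a b}.
Proof.
by move=> a b; elim/L0W: x => f; rewrite !L0_scaleE scalerDl L0_addE.
Qed.

HB.instance Definition _ :=
  GRing.Zmodule_isLmodule.Build R L0 scaleA scale1 scaleDr scaleDl.

Let lt_def x y : L0_lt x y = (y != x) && L0_le x y.
Proof. by []. Qed.

Let le_refl : reflexive L0_le.
Proof. by elim/L0W => f; apply/L0_leP; apply: aeW => t. Qed.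

Let le_anti : antisymmetric L0_le.
Proof.
elim/L0W => f; elim/L0W => g /andP[/L0_leP fg /L0_leP gf].
apply/L0_classP; apply: filterS2 fg gf => t fg gf.
by apply/eqP; rewrite eq_le fg.
Qed.

Let le_tr : transitive L0_le.
Proof.
elim/L0W => g; elim/L0W => f; elim/L0W => h /L0_leP fg /L0_leP gh.
by apply/L0_leP; apply: filterS2 fg gh => t; exact: le_trans.
Qed.

HB.instance Definition _ :=
  Order.isPOrder.Build ring_display L0 lt_def le_refl le_anti le_tr.

Let lexI x y z : (x <= L0_meet y z) = (x <= y) && (x <= z).
Proof.
elim/L0W: x => f; elim/L0W: y => g; elim/L0W: z => h; rewrite L0_meetE.
apply/idP/andP => [/L0_leP H|[/L0_leP fg /L0_leP fh]].
  by split; apply/L0_leP; apply: filterS H => t; rewrite le_min => /andP[].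
by apply/L0_leP; apply: filterS2 fg fh => t; rewrite le_min => -> ->.
Qed.

Let leUx x y z : (L0_join x y <= z) = (x <= z) && (y <= z).
Proof.
elim/L0W: x => f; elim/L0W: y => g; elim/L0W: z => h; rewrite L0_joinE.
apply/idP/andP => [/L0_leP H|[/L0_leP fg /L0_leP fh]].
  by split; apply/L0_leP; apply: filterS H => t; rewrite ge_max => /andP[].
by apply/L0_leP; apply: filterS2 fg fh => t; rewrite ge_max => -> ->.
Qed.

Let leD2r x y z : x <= y -> x + z <= y + z.
Proof.
elim/L0W: x => f; elim/L0W: y => g; elim/L0W: z => h /L0_leP fg.
rewrite [X in X <= _]L0_addE [X in _ <= X]L0_addE.
by apply/L0_leP; apply: filterS fg => t fg; rewrite /= lerD2r.
Qed.

Let scale_ge0 a x : 0 <= a -> 0 <= x -> 0 <= a *: x.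
Proof.
move=> a0; elim/L0W: x => f /L0_leP f0.
rewrite [X in _ <= X]L0_scaleE.
by apply/L0_leP; apply: filterS f0 => t f0; rewrite /= mulr_ge0.
Qed.

HB.instance Definition _ := 
  isVectorLattice.Build R L0 lexI leUx leD2r scale_ge0.

Definition L0_restrict (A : set T) (mA : measurable A) x : L0 :=
  L0_class (L0_fun x * indic_mfun A mA).

(* The measure of this set does not depend on the representative [L0_fun]. *)
Definition cvg_in_measure dI (I : preorderType dI) (y : I -> L0) (l : L0) :
    Prop :=
  forall e : R, 0 < e ->
    mu [set t | e < `|L0_fun (y i - l) t|] @[i --> net_filter I] --> 0%E.

Definition is_banach_function_space (P : pred L0) (X : banachSubspaceType P) :
    Prop :=
  [/\ ideal P, order_dense P & lattice_norm X].

End L0_vector_lattice.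

(* Main.v *)
Require Import Defs.
From HB Require Import structures.
From mathcomp Require Import all_boot all_order all_algebra.
From mathcomp Require Import all_classical all_reals all_analysis.
From mathcomp Require Import measurable_realfun lra.
Import Order.TTheory GRing.Theory Num.Theory.
Import numFieldNormedType.Exports.
Local Open Scope classical_set_scope.
Local Open Scope ring_scope.
Set Implicit Arguments.
Unset Strict Implicit.
Unset Printing Implicit Defensive.

(** Both implications compare two ways of measuring how small a measurable set
    [C] is: by [mu C], and by the norm in [X] of [x * 1_C], where [x >= 0] is
    a fixed element of [X]. On a set of finite measure where [x > 0], each
    controls the other.
    - [fnorm_abs_continuous]: if [mu C] is small, so is the norm of [x * 1_C].
      Otherwise there are sets with summable measures and norms bounded below;
      their tail unions decrease to a null set, which contradicts order
      continuity.
    - [measure_abs_continuous]: if the norm of [x * 1_C] is small, so is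
      [mu C]. Otherwise there are sets with geometrically small norms and
      measures bounded below; their upper limit has positive measure, but the
      norm is countably subadditive by order continuity ([fnorm_bigcup]), so
      that [x] vanishes a.e. on this upper limit.

    Convergence in measure implies un-convergence because [|y| /\ x] is at most
    the sum of [x] outside a set [A] of finite measure, [x] on the part of [A]
    where [|y| > c], and [x /\ c] ([fnorm_min_split]). Order continuity makes
    the first term small for a suitable [A], because [mu] is sigma-finite, and the
    last one small for a suitable [c]; then the middle one is small as soon as
    its support has small measure.

    Conversely, given [A] of finite measure and a threshold [c], order density
    provides [f >= 0] in [X] that vanishes on a subset of [A] of small measure
    only ([almost_full_support]). For [x := f /\ c] one has
    [x * 1_C <= |y| /\ x] with [C] the part of [A] where [|y| > c] and [f > 0],
    so that un-convergence makes the norm of [x * 1_C], hence [mu C], small.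

    The argument is carried out for measurable functions, without mention of
    classes: [fdom] and [fnorm] pull membership in [X] and its norm back along
    the quotient map. Order continuity is applied to sequences only. *)

(** * Measures and measurable functions *)

Section measurable_functions.
Context d (T : measurableType d) (R : realType).
Implicit Types f : {mfun T >-> R}.

Lemma measurable_mfun_gt f (c : R) : measurable [set t | c < f t].
Proof.
have -> : [set t | c < f t] = [set: T] `&` f @^-1` `]c, +oo[.
  by apply/seteqP; split=> t /=; rewrite in_itv/= andbT; [split|case].
exact: (measurable_funPT f).
Qed.

Lemma measurable_mfun_le f (c : R) : measurable [set t | f t <= c].
Proof.
have -> : [set t | f t <= c] = ~` [set t | c < f t].
  by apply/seteqP; split=> t /=; rewrite leNgt => /negP.
exact/measurableC/measurable_mfun_gt.
Qed.

Definition abs_mfun f : {mfun T >-> R} := max_mfun f (- f).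

Lemma abs_mfunE f t : abs_mfun f t = `|f t|.
Proof. exact: maxrN. Qed.

Lemma mul_indic_in f B (mB : measurable B) t : B t ->
  (f * indic_mfun B mB) t = f t.
Proof. by move=> Bt; rewrite -[LHS]/(f t * \1_B t) indicE mem_set// mulr1. Qed.

Lemma mul_indic_out f B (mB : measurable B) t : ~ B t ->
  (f * indic_mfun B mB) t = 0.
Proof. by move=> Bt; rewrite -[LHS]/(f t * \1_B t) indicE memNset// mulr0. Qed.

Lemma mul_indic_ge0 f B (mB : measurable B) t : 0 <= f t ->
  0 <= (f * indic_mfun B mB) t.
Proof.
have [Bt|Bt] := pselect (B t); first by rewrite mul_indic_in.
by rewrite (mul_indic_out _ _ Bt).
Qed.

Lemma mul_indic_subset f A B (mA : measurable A) (mB : measurable B) t :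
  A `<=` B -> 0 <= f t -> (f * indic_mfun A mA) t <= (f * indic_mfun B mB) t.
Proof.
move=> AB ft; have [At|At] := pselect (A t); last first.
  by rewrite (mul_indic_out _ _ At) mul_indic_ge0.
by rewrite (mul_indic_in _ _ At) mul_indic_in//; exact: AB.
Qed.

End measurable_functions.

Section measure_facts.
Context d (T : measurableType d) (R : realType).
Context (mu : {measure set T -> \bar R}).

Lemma measure_bigcap_ge (F : nat -> set T) (a : \bar R) :
  (forall n, measurable (F n)) -> (mu (F 0%N) < +oo)%E ->
  (forall n, F n.+1 `<=` F n) -> (forall n, (a <= mu (F n))%E) ->
  (a <= mu (\bigcap_n F n))%E.
Proof.
move=> mF F0 Fdecr aF.
apply: (cvge_ge _ (nonincreasing_cvg_mu F0 mF _ _)); first exact: nearW.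
- exact: bigcap_measurable.
- by apply/nonincreasing_seqP => n; apply/subsetPset.
Qed.

Lemma ae_le_measure (A B : set T) : measurable A -> measurable B ->
  (\forall t \ae mu, A t -> B t) -> (mu A <= mu B)%E.
Proof.
move=> mA mB [N [mN N0 AB]]; rewrite -(measureU0 mB mN N0).
apply: le_measure; rewrite ?inE//; first exact: measurableU.
move=> t At; have [Bt|Bt] := pselect (B t); [by left|right].
by apply: AB => /= /(_ At).
Qed.

Lemma ae_eq_measure (A B : set T) : measurable A -> measurable B ->
  (\forall t \ae mu, A t <-> B t) -> mu A = mu B.
Proof.
move=> mA mB AB; apply/eqP; rewrite eq_le !ae_le_measure//;
by apply: filterS AB => t [].
Qed.

Lemma cvge0P (I : Type) (F : set_system I) (m : I -> \bar R) :
  ProperFilter F -> (forall i, (0 <= m i)%E) ->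
  m i @[i --> F] --> 0%E <->
  (forall e : R, 0 < e -> \forall i \near F, (m i < e%:E)%E).
Proof.
move=> PF m0; split=> [/fine_cvgP[mfin /cvgr0_norm_lt m_0] e e0|m_0].
  apply: filterS2 mfin (m_0 e e0) => i mi /=.
  by rewrite ger0_norm ?fine_ge0// -lte_fin fineK.
apply/fine_cvgP; split.
  by apply: filterS (m_0 1 ltr01) => i mi; rewrite ge0_fin_numE// (lt_trans mi) ?ltry.
apply/cvgr0Pnorm_lt => e e0; apply: filterS (m_0 e e0) => i mi /=.
by rewrite ger0_norm ?fine_ge0// -lte_fin fineK// ge0_fin_numE// (lt_trans mi) ?ltry.
Qed.

End measure_facts.

(** * The norm of a Banach function space on measurable functions *)

Section function_norm.
Context d (T : measurableType d) (R : realType).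
Context (mu : {measure set T -> \bar R}).
Context (P : pred (L0 mu)) (X : banachSubspaceType P).
Implicit Types f g h x : {mfun T >-> R}.

Definition fdom f : bool := P (L0_class mu f).

(** Meaningful on [fdom] only: elsewhere [insubd] falls back to [0]. *)
Definition fnorm f : R := `|insubd (0 : X) (L0_class mu f)|.

Lemma vabs_class f : vabs (L0_class mu f) = L0_class mu (abs_mfun f).
Proof.
rewrite /vabs.
have -> : - L0_class mu f = L0_class mu (- f) by exact: L0_oppE.
exact: L0_joinE.
Qed.

Lemma fnorm_val f (x : X) : val x = L0_class mu f -> fnorm f = `|x|.
Proof. by move=> xf; rewrite /fnorm -xf valKd. Qed.

Lemma fnorm_ge0 f : 0 <= fnorm f.
Proof. exact: normr_ge0. Qed.

Context (hX : is_banach_function_space X).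

Lemma fdom_le f g : (\forall t \ae mu, 0 <= f t <= g t) -> fdom g -> fdom f.
Proof.
case: hX => [[_ _ solid] _ _] fg gX; apply: solid gX _.
rewrite !vabs_class; apply/L0_leP; apply: filterS fg => t /andP[f0 fg].
by rewrite !abs_mfunE !ger0_norm// (le_trans f0).
Qed.

Lemma fnorm_le f g : (\forall t \ae mu, 0 <= f t <= g t) -> fdom g ->
  fnorm f <= fnorm g.
Proof.
move=> fg gX; have fX := fdom_le fg gX; case: hX => _ _; apply.
rewrite !insubdK// !vabs_class; apply/L0_leP; apply: filterS fg => t /andP[f0 fg].
by rewrite !abs_mfunE !ger0_norm// (le_trans f0).
Qed.

Lemma L0_classD f g : L0_class mu (f + g) = L0_class mu f + L0_class mu g.
Proof. by rewrite [RHS]L0_addE. Qed.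

Lemma fdomD f g : fdom f -> fdom g -> fdom (f + g).
Proof.
case: hX => [[P0 Plin _] _ _] fX gX.
by rewrite /fdom L0_classD -[L0_class mu f]scale1r Plin.
Qed.

Lemma fnormD f g : fdom f -> fdom g -> fnorm (f + g) <= fnorm f + fnorm g.
Proof.
move=> fX gX; apply: le_trans (ler_normD _ _).
rewrite (@fnorm_val _ (insubd 0 (L0_class mu f) + insubd 0 (L0_class mu g)))//.
by rewrite raddfD /= !insubdK// L0_classD.
Qed.

Lemma fnorm_eq0 f : fdom f -> fnorm f = 0 -> \forall t \ae mu, f t = 0.
Proof.
move=> fX /eqP; rewrite normr_eq0 => /eqP f0.
have : L0_class mu f = L0_class mu 0.
  have <- := insubdK (0 : X) fX; rewrite f0; exact: raddf0.
by move=> /L0_classP; apply: filterS => t ->.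
Qed.

Context (hXoc : order_continuous X).

(** A measurable lower bound of all the [f_ n] is, outside the union of
    countably many null sets, a pointwise lower bound, hence nonpositive; so a
    pointwise decrease to [0] is an order decrease to [0] in [X]. *)
Lemma fnorm_order_continuous (f_ : nat -> {mfun T >-> R}) (e : R) :
  fdom (f_ 0%N) ->
  (\forall t \ae mu, forall n, 0 <= f_ n.+1 t <= f_ n t) ->
  (\forall t \ae mu, forall a, 0 < a -> exists n, f_ n t < a) ->
  0 < e -> exists n, fnorm (f_ n) < e.
Proof.
move=> f0X fdecr fto0 e0.
have fX n : fdom (f_ n).
  elim: n => [//|n]; apply: fdom_le; apply: filterS fdecr => t; exact.
have dirN : directed nat.
  split=> [|i j]; first exact: (inhabits 0%N).
  by exists (maxn i j); split; [exact: leq_maxl|exact: leq_maxr].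
have /(hXoc dirN) : decreases_to0 (fun n => insubd (0 : X) (L0_class mu (f_ n))).
  split=> [i j ij|i|z zf]; rewrite ?(insubdK (0 : X) (fX _)).
  - apply/L0_leP; apply: filterS fdecr => t fdecr.
    by apply: (@nonincreasing_seqP _ _ (f_^~ t)).1 => // n; case/andP: (fdecr n).
  - apply/L0_leP.
    by apply: filterS fdecr => t /(_ i)/andP[h1 h2]; exact: (le_trans h1 h2).
  - elim/L0W: (val z) zf => h hf.
    apply/L0_leP; have /ae_foralln : forall n, \forall t \ae mu, h t <= f_ n t.
      by move=> n; apply/L0_leP; rewrite -(insubdK (0 : X) (fX n)); exact: hf.
    move: fto0; apply: filterS2 => t fto0 hft; rewrite leNgt; apply/negP => h0.
    by have [n] := fto0 _ h0; rewrite ltNge hft.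
have PF := net_filter_proper dirN.
move=> /cvgr0_norm_lt => /(_ e e0)[n _ /(_ n (lexx n))].
rewrite ger0_norm ?normr_ge0// => fn.
by exists n.
Qed.

(** * Norm of the restrictions of a function *)

Lemma fdom_indic x B (mB : measurable B) : (\forall t \ae mu, 0 <= x t) ->
  fdom x -> fdom (x * indic_mfun B mB).
Proof.
move=> x0; apply: fdom_le; apply: filterS x0 => t x0.
rewrite mul_indic_ge0// andTb; have [Bt|Bt] := pselect (B t).
  by rewrite mul_indic_in.
by rewrite (mul_indic_out _ _ Bt).
Qed.

Lemma fnorm_indic_subset x A B (mA : measurable A) (mB : measurable B) :
  (\forall t \ae mu, 0 <= x t) -> fdom x -> A `<=` B ->
  fnorm (x * indic_mfun A mA) <= fnorm (x * indic_mfun B mB).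
Proof.
move=> x0 xX AB; apply: fnorm_le; last exact: fdom_indic.
by apply: filterS x0 => t x0; rewrite mul_indic_ge0// andTb mul_indic_subset.
Qed.

Lemma fnorm_indic_subsetU x A B C
    (mA : measurable A) (mB : measurable B) (mC : measurable C) :
  (\forall t \ae mu, 0 <= x t) -> fdom x -> A `<=` B `|` C ->
  fnorm (x * indic_mfun A mA) <=
  fnorm (x * indic_mfun B mB) + fnorm (x * indic_mfun C mC).
Proof.
move=> x0 xX ABC; have xI D mD := @fdom_indic x D mD x0 xX.
apply: le_trans (fnormD (xI _ mB) (xI _ mC)).
apply: fnorm_le; last exact: fdomD.
apply: filterS x0 => t x0; rewrite mul_indic_ge0// andTb mfunD /(_ \+ _).
have [At|At] := pselect (A t); last first.
  by rewrite (mul_indic_out _ _ At) addr_ge0 ?mul_indic_ge0.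
rewrite (mul_indic_in _ _ At); case: (ABC _ At) => BCt.
  by rewrite (mul_indic_in _ _ BCt) lerDl mul_indic_ge0.
by rewrite (mul_indic_in _ _ BCt) lerDr mul_indic_ge0.
Qed.

Lemma fnorm_shrinking x (B : nat -> set T) (mB : forall n, measurable (B n)) e :
  (\forall t \ae mu, 0 <= x t) -> fdom x ->
  (forall n, B n.+1 `<=` B n) -> (\forall t \ae mu, exists n, ~ B n t) ->
  0 < e -> exists n, fnorm (x * indic_mfun (B n) (mB n)) < e.
Proof.
move=> x0 xX Bdecr B0 e0.
apply: (@fnorm_order_continuous
  (fun n => x * indic_mfun (B n) (mB n))) => //; first exact: fdom_indic.
- apply: filterS x0 => t x0 n.
  by rewrite mul_indic_ge0// andTb mul_indic_subset.
- by apply: filterS B0 => t [n Bnt] a a0; exists n; rewrite mul_indic_out.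
Qed.

(** Countable subadditivity, for geometrically decreasing bounds. Finite
    subadditivity handles the first [m] sets; what they leave uncovered shrinks
    to the empty set as [m] grows, so its norm tends to [0]. *)
Lemma fnorm_bigcup x (C : nat -> set T) (mC : forall n, measurable (C n))
    (mUC : measurable (\bigcup_n C n)) (b : R) :
  (\forall t \ae mu, 0 <= x t) -> fdom x ->
  (forall n, fnorm (x * indic_mfun (C n) (mC n)) <= b / 2 ^+ n.+1) ->
  fnorm (x * indic_mfun _ mUC) <= b.
Proof.
move=> x0 xX NC.
pose G n := (\bigcup_k C k) `\` (\bigcup_(k in `I_n) C k).
have mG n : measurable (G n) by apply: measurableD => //; exact: bigcup_measurable.
(* [b * (1 - 2 ^- n)] is the sum of the first [n] bounds. *)
have step n : fnorm (x * indic_mfun _ mUC) <=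
    b * (1 - 2 ^- n) + fnorm (x * indic_mfun _ (mG n)).
  elim: n => [|n IHn].
    rewrite expr0 invr1 subrr mulr0 add0r; apply: fnorm_indic_subset => //.
    by move=> t Ct; split=> // -[].
  apply: le_trans IHn _.
  have GC : G n `<=` C n `|` G n.+1.
    move=> t [UCt nC]; have [Ct|Ct] := pselect (C n t); [by left|right].
    split=> // -[k /=]; rewrite ltnS leq_eqVlt => /predU1P[->//|kn] Ckt.
    by apply: nC; exists k.
  have := fnorm_indic_subsetU (mG n) (mC n) (mG n.+1) x0 xX GC.
  have := NC n; rewrite [2 ^+ n.+1]exprS invfM.
  by lra.
have b0 : 0 <= b.
  by have := le_trans (fnorm_ge0 _) (NC 0%N); rewrite expr1; lra.
apply/ler_addgt0Pr => e e0.
have [||m Gm] := fnorm_shrinking mG x0 xX _ _ e0.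
- move=> n t [UCt nC]; split=> // -[k kn Ckt]; apply: nC; exists k => //=.
  exact: ltnW.
- apply: aeW => t; have [[n _ Cnt]|UCt] := pselect ((\bigcup_k C k) t).
    by exists n.+1 => -[_]; apply; exists n => //=.
  by exists 0%N => -[].
have p0 : 0 <= 2 ^- m :> R by rewrite invr_ge0 exprn_ge0.
have := step m; have := mulr_ge0 b0 p0; lra.
Qed.

(** If this fails, choose sets of measure less than [2 ^- n.+1] on which the
    norm of [x] is at least [e]. Their tail unions decrease to a set that is
    null by the Borel-Cantelli lemma, so the norm on some tail union is less
    than [e], although this union contains one of the chosen sets. *)
Lemma fnorm_abs_continuous x e :
  (\forall t \ae mu, 0 <= x t) -> fdom x -> 0 < e ->
  exists2 dl : R, 0 < dl & forall B (mB : measurable B), (mu B < dl%:E)%E ->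
    fnorm (x * indic_mfun B mB) < e.
Proof.
move=> x0 xX e0; apply: contrapT => H.
have /choice[B HB] : forall n, exists B : {B : set T | measurable B},
    (mu (sval B) < (1 / (2 ^ n.+1)%:R)%:E)%E /\
    e <= fnorm (x * indic_mfun (sval B) (proj2_sig B)).
  move=> n; apply: contrapT => HB; apply: H.
  exists (1 / (2 ^ n.+1)%:R); first by rewrite divr_gt0// ltr0n expn_gt0.
  move=> B mB muB; rewrite ltNge; apply/negP => eB.
  by apply: HB; exists (exist _ B mB); split.
pose F n := sval (B n); pose mF n : measurable (F n) := proj2_sig (B n).
pose C n := \bigcup_(k >= n) F k.
have mC n : measurable (C n) by apply: bigcup_measurable.
have F0 : mu (lim_sup_set F) = 0%E.
  apply: lim_sup_set_cvg0 => //; apply: le_lt_trans (ltry 1).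
  apply: le_trans (epsilon_trick0 xpredT ler01).
  by apply: lee_nneseries => // n _; have [/ltW] := HB n.
have mlim : measurable (lim_sup_set F).
  by apply: bigcap_measurable => // n _; exact: mC.
have [||n] := fnorm_shrinking mC x0 xX _ _ e0.
- move=> n t [k /= nk Fkt]; exists k => //=; exact: ltnW.
- exists (lim_sup_set F); split=> // t /= /forallNP nC n _.
  exact: (contrapT (nC n)).
- apply/negP; rewrite -leNgt; have [_ /le_trans] := HB n; apply.
  by apply: fnorm_indic_subset => // t Ft; exists n => //=.
Qed.

(** If this fails, choose subsets of [A] of measure at least [e] on which the
    norm of [x] is less than [2 ^- n]. Since [A] has finite measure, their upper
    limit has measure at least [e]. As it is contained in every tail union, the
    restriction of [x] to it has norm at most [2 * 2 ^- n] for every [n] by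
    countable subadditivity, so [x] vanishes a.e. on it, although [x > 0] on
    [A]. *)
Lemma measure_abs_continuous x A e : measurable A -> (mu A < +oo)%E ->
  (\forall t \ae mu, 0 <= x t) -> (forall t, A t -> 0 < x t) -> fdom x ->
  0 < e ->
  exists2 dl : R, 0 < dl & forall C (mC : measurable C), C `<=` A ->
    fnorm (x * indic_mfun C mC) < dl -> (mu C < e%:E)%E.
Proof.
move=> mA Aoo x0 xA xX e0; apply: contrapT => H.
have /choice[B HB] : forall n, exists B : {B : set T | measurable B},
    [/\ sval B `<=` A,
        fnorm (x * indic_mfun (sval B) (proj2_sig B)) < 2 ^- n &
        (e%:E <= mu (sval B))%E].
  move=> n; apply: contrapT => HB; apply: H.
  exists (2 ^- n); first by rewrite invr_gt0 exprn_gt0.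
  move=> C mC CA NC; rewrite ltNge; apply/negP => eC.
  by apply: HB; exists (exist _ C mC); split.
pose F n := sval (B n); pose mF n : measurable (F n) := proj2_sig (B n).
have mC n : measurable (\bigcup_(k >= n) F k) by apply: bigcup_measurable.
have mlim : measurable (lim_sup_set F).
  by apply: bigcap_measurable => // n _; exact: mC.
have muC n : (e%:E <= mu (\bigcup_(k >= n) F k))%E.
  have [_ _ /le_trans] := HB n; apply; apply: le_measure; rewrite ?inE.
  - exact: mF.
  - exact: mC.
  - by apply: (bigcup_sup (P := fun k => (n <= k)%N)) => /=.
have lim_ge : (e%:E <= mu (lim_sup_set F))%E.
  apply: (cvge_ge _ (lim_sup_set_cvg mu F mF _)); first exact: nearW.
  apply: le_lt_trans Aoo; rewrite le_measure ?inE//.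
  by apply: bigcup_sub => k _; case: (HB k).
have Nlim n : fnorm (x * indic_mfun _ mlim) <= 2 * 2 ^- n.
  have mU : measurable (\bigcup_k F (n + k)%N) by apply: bigcup_measurable.
  apply: (@le_trans _ _ (fnorm (x * indic_mfun _ mU))).
    apply: fnorm_indic_subset => // t /(_ n I)[k /= nk Fkt].
    by exists (k - n)%N => //; rewrite subnKC.
  apply: (@fnorm_bigcup x (fun k => F (n + k)%N) (fun k => mF (n + k)%N) mU) => // k.
  have [_ /ltW/le_trans + _] := HB (n + k)%N; apply.
  by rewrite exprS invfM mulrACA divff// mul1r exprD invfM lexx.
have : fnorm (x * indic_mfun _ mlim) = 0.
  apply/eqP; rewrite eq_le fnorm_ge0 andbT; apply/ler_addgt0Pr => r r0.
  have r2 : 0 < r / 2 by lra.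
  have := @cvg_geometric R 1 (2^-1) _; rewrite ger0_norm ?invr_ge0//.
  move=> /(_ ltac:(lra)) /cvgr0_norm_lt => /(_ _ r2)[n _ /(_ n (leqnn n))].
  rewrite /= mul1r exprVn ger0_norm ?invr_ge0 ?exprn_ge0// => nr.
  by have := Nlim n; lra.
move/(fnorm_eq0 (fdom_indic mlim x0 xX)) => [Z [mZ Z0 lZ]].
have : (mu (lim_sup_set F) <= mu Z)%E.
  rewrite le_measure ?inE// => t limt; apply: lZ => xt.
  have : 0 < x t.
    apply: xA; have [k _ Fkt] := limt 0%N I.
    by have [+ _ _] := HB k; apply.
  by rewrite -(mul_indic_in x mlim limt) xt ltxx.
by rewrite Z0 => /(le_trans lim_ge); rewrite lee_fin leNgt e0.
Qed.

(** * Functions of the space with almost full support *)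

(** The positive part replaces a representative of the class given by order
    density by one that is nonnegative everywhere. *)
Lemma order_dense_indic Z (mZ : measurable Z) : (0 < mu Z)%E ->
  exists g, [/\ forall t, 0 <= g t, fdom g, \forall t \ae mu, 0 < g t -> Z t &
               (0 < mu [set t | (0 < g t)%R])%E].
Proof.
move=> Z0; have [_ dense _] := hX.
have /dense[x [xX x0 xZ]] : 0 < L0_class mu (indic_mfun Z mZ).
  rewrite lt_neqAle; apply/andP; split.
    apply/eqP => /L0_classP; rewrite -/(almost_everywhere _ _) => -[N [mN N0 ZN]].
    suff : (mu Z <= mu N)%E by rewrite N0 leNgt Z0.
    apply: le_measure; rewrite ?inE// => t Zt; apply: ZN => /=.
    by rewrite /mindic indicE mem_set// => /esym/eqP; rewrite oner_eq0.
  by apply/L0_leP; apply: aeW => t /=; rewrite /mindic indicE.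
move: xX x0 xZ; elim/L0W: x => g gX g0 /L0_leP gZ.
have g_ge0 : \forall t \ae mu, 0 <= g t.
  by have /L0_leP := ltW g0; apply: filterS.
have gmaxE t : max_mfun g 0 t = Num.max (g t) 0 by [].
have gmax : L0_class mu (max_mfun g 0) = L0_class mu g.
  apply/L0_classP; apply: filterS g_ge0 => t gt0.
  by rewrite gmaxE; apply/max_idPl.
exists (max_mfun g 0); split.
- by move=> t; rewrite gmaxE le_max lexx orbT.
- by rewrite /fdom gmax.
- apply: filterS gZ => t; rewrite gmaxE lt_max ltxx orbF => gtZ gt0.
  apply: contrapT => Zt; move: gtZ; rewrite /= /mindic indicE memNset//.
  by rewrite leNgt gt0.
- rewrite lt_neqAle measure_ge0 andbT; apply/eqP => muG.
  move: g0; rewrite lt_neqAle => /andP[/eqP + _]; apply.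
  have G : \forall t \ae mu, ~ 0 < max_mfun g 0 t.
    exists [set t | 0 < max_mfun g 0 t]; split=> //.
      exact: measurable_mfun_gt.
    by move=> t /= /contrapT.
  apply/L0_classP; apply: filterS2 g_ge0 G => t gt0.
  rewrite gmaxE lt_max ltxx orbF => /negP; rewrite -leNgt => g_le0.
  by apply/eqP; rewrite eq_le gt0.
Qed.

(** Choose [x n] whose zero set in [A] has minimal measure up to [n.+1^-1]. The
    zero sets [Z n] of the partial sums decrease to a set of measure at most the
    infimum. Were it not null, order density would provide a nonzero [g] in [X]
    that vanishes a.e. outside it, and adding [g] to the partial sums would
    yield zero sets whose measures tend to a limit below the infimum. Hence
    [mu (Z n)] tends to [0]. *)
Lemma almost_full_support A (e : R) : measurable A -> (mu A < +oo)%E -> 0 < e ->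
  exists x, [/\ forall t, 0 <= x t, fdom x &
    (mu (A `&` [set t | (x t <= 0)%R]) < e%:E)%E].
Proof.
move=> mA Aoo e0.
have addE (f g : {mfun T >-> R}) t : (f + g) t = f t + g t by [].
have add_le0 (a b : R) : 0 <= a -> 0 <= b ->
    (a + b <= 0) = (a <= 0) && (b <= 0).
  by move=> a0 b0; apply/idP/andP => [|[]]; lra.
pose S := [set m | exists x, [/\ forall t, 0 <= x t, fdom x &
  m = mu (A `&` [set t | (x t <= 0)%R])]].
have mzero x : measurable (A `&` [set t | x t <= 0]).
  by apply: measurableI => //; exact: measurable_mfun_le.
have zero_fin x : (mu (A `&` [set t | (x t <= 0)%R]) < +oo)%E.
  by apply: le_lt_trans Aoo; apply: le_measure; rewrite ?inE//; exact: subIsetl.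
have X0 : fdom (0 : {mfun T >-> R}) by case: hX => -[].
have S_fin : ereal_inf S \is a fin_num.
  rewrite ge0_fin_numE.
    by apply: le_lt_trans (zero_fin 0); apply: ereal_inf_lbound; exists 0.
  by apply: le_ereal_inf_tmp => _ [x [_ _ ->]].
have /choice[x xP] : forall n, exists x, [/\ forall t, 0 <= x t, fdom x &
    (mu (A `&` [set t | (x t <= 0)%R]) < ereal_inf S + (n.+1%:R^-1)%:E)%E].
  move=> n; have n0 : 0 < n.+1%:R^-1 :> R by rewrite invr_gt0.
  have [_ [x [x0 xX ->]] xn] := lb_ereal_inf_adherent n0 S_fin.
  by exists x.
pose z n := \sum_(k < n.+1) x k.
have zS n : z n.+1 = z n + x n.+1 by rewrite /z big_ord_recr.
have z0 n t : 0 <= z n t.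
  by rewrite mfun_sum; apply: sumr_ge0 => k _; case: (xP k).
have zX n : fdom (z n).
  elim: n => [|n IHn]; first by rewrite /z big_ord1; case: (xP 0%N).
  by rewrite zS; apply: fdomD => //; case: (xP n.+1).
have xz n t : x n t <= z n t.
  case: n => [|n]; first by rewrite /z big_ord1.
  by rewrite zS addE lerDr.
pose Z n := A `&` [set t | z n t <= 0].
have mZ n : measurable (Z n) by exact: mzero.
have Zdecr n : Z n.+1 `<=` Z n.
  move=> t [At zt]; split=> //=; apply: le_trans zt.
  by rewrite zS addE lerDl; case: (xP n.+1).
have mbZ : measurable (\bigcap_n Z n) by exact: bigcap_measurable.
have bZ_inf : (mu (\bigcap_n Z n) <= ereal_inf S)%E.
  apply/lee_addgt0Pr => r r0.
  have [n] := ltr_add_invr r0; rewrite add0r => nr.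
  have [_ _ /ltW xn] := xP n.
  apply: (@le_trans _ _ (ereal_inf S + (n.+1%:R^-1)%:E)%E).
    apply: le_trans xn; apply: le_measure; rewrite ?inE//.
    move=> t /(_ n I)[At zt]; split=> //=; exact: le_trans (xz _ _) zt.
  by rewrite leeD2l// lee_fin ltW.
have bZ0 : mu (\bigcap_n Z n) = 0%E.
  apply/eqP; rewrite eq_le measure_ge0 andbT leNgt; apply/negP => bZ0.
  have [g [g0 gX gZ muG]] := order_dense_indic mbZ bZ0.
  pose V := [set t | g t <= 0].
  have mV : measurable V by exact: measurable_mfun_le.
  have : (ereal_inf S <= mu (\bigcap_n (Z n `&` V)))%E.
    apply: measure_bigcap_ge => [n|||n].
    - exact: measurableI.
    - apply: le_lt_trans Aoo; apply: le_measure; rewrite ?inE//.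
        exact: measurableI.
      by move=> t [[]].
    - by move=> n t [/Zdecr].
    - apply: ereal_inf_lbound; exists (z n + g); split.
      + by move=> t; rewrite addE addr_ge0.
      + exact: fdomD.
      + congr (mu _); apply/seteqP; split=> t;
          rewrite /Z /V /setI /mkset addE add_le0//.
          by move=> [[At ->] ->].
        by move=> [At /andP[]].
  rewrite bigcapIl; last by exists 0%N.
  move=> /(le_trans bZ_inf).
  have mW : measurable (\bigcap_n Z n `\` V) by exact: measurableD.
  rewrite (measureDI mu mbZ mV) leNgt lteDr; last first.
    rewrite ge0_fin_numE//; apply: le_lt_trans Aoo.
    apply: le_measure; rewrite ?inE//; first exact: measurableI.
    by move=> t [/(_ 0%N I)[]].
  move=> /negP; apply; apply: lt_le_trans muG _.
  apply: ae_le_measure => //; first exact: measurable_mfun_gt.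
  apply: filterS gZ => t gZ gt; split; first exact: gZ.
  by rewrite /V /= leNgt gt.
apply: contrapT => H.
have : (e%:E <= mu (\bigcap_n Z n))%E.
  apply: measure_bigcap_ge => // [|n]; first exact: zero_fin.
  rewrite leNgt; apply/negP => Zn.
  by apply: H; exists (z n).
by rewrite bZ0 lee_fin leNgt e0.
Qed.

(** * Decomposition of a truncated function *)

Lemma fnorm_tail x (e : R) : sigma_finite [set: T] mu ->
  (\forall t \ae mu, 0 <= x t) -> fdom x -> 0 < e ->
  exists A (mA : measurable A), (mu A < +oo)%E /\
    fnorm (x * indic_mfun _ (measurableC mA)) < e.
Proof.
move=> /sigma_finiteP[F [FT Fincr /all_and2[mF Ffin]]] x0 xX e0.
have [||n] := fnorm_shrinking (fun n => measurableC (mF n)) x0 xX _ _ e0.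
- by move=> n; apply: subsetC; apply/subsetPset; apply: Fincr.
- apply: aeW => t; have [n _ Fnt] : (\bigcup_n F n) t by rewrite -FT.
  by exists n => /(_ Fnt).
- by move=> Ne; exists (F n), (mF n); split=> //; exact: Ffin.
Qed.

Lemma fnorm_min_cst x (e : R) :
  (\forall t \ae mu, 0 <= x t) -> fdom x -> 0 < e ->
  exists2 c : R, 0 < c & fnorm (min_mfun x (cst c)) < e.
Proof.
move=> x0 xX e0.
have minE c t : min_mfun x (cst c) t = Num.min (x t) c by [].
have c0 n : (0 : R) < n.+1%:R^-1 by rewrite invr_gt0.
have [|||n] := @fnorm_order_continuous
    (fun n => min_mfun x (cst n.+1%:R^-1)) e _ _ _ e0.
- apply: fdom_le xX; apply: filterS x0 => t x0.
  by rewrite minE le_min x0 ge_min lexx ltW.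
- apply: filterS x0 => t x0 n; rewrite !minE le_min x0 ltW//=.
  by rewrite le_min !ge_min lexx/= lef_pV2 ?posrE// ler_nat leqnSn orbT.
- apply: aeW => t a a0; have [n] := ltr_add_invr a0; rewrite add0r => na.
  by exists n; rewrite minE gt_min na orbT.
- by exists n.+1%:R^-1.
Qed.

(** At each point one of the three functions on the right dominates
    [min h x]: the first off [A], the second on [A] where [h > c], the third on
    [A] where [h <= c]. *)
Lemma fnorm_min_split h x A (mA : measurable A) (c : R) :
  (forall t, 0 <= h t) -> (\forall t \ae mu, 0 <= x t) -> fdom x -> 0 <= c ->
  fnorm (min_mfun h x) <= fnorm (x * indic_mfun _ (measurableC mA))
    + fnorm (x * indic_mfun _ (measurableI _ _ mA (measurable_mfun_gt h c)))
    + fnorm (min_mfun x (cst c)).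
Proof.
move=> h0 x0 xX c0.
have minE f g t : min_mfun f g t = Num.min (f t) (g t) by [].
have addE f g t : (f + g) t = f t + g t by [].
set x1 := x * _; set x2 := x * _; set x3 := min_mfun x _.
have x1X : fdom x1 by exact: fdom_indic.
have x2X : fdom x2 by exact: fdom_indic.
have x3X : fdom x3.
  apply: fdom_le xX; apply: filterS x0 => t x0.
  by rewrite minE le_min x0 ge_min lexx c0.
have x12X : fdom (x1 + x2) by exact: fdomD.
apply: (@le_trans _ _ (fnorm (x1 + x2 + x3))); last first.
  apply: le_trans (fnormD x12X x3X) _; rewrite lerD2r.
  exact: fnormD.
apply: fnorm_le; last exact: fdomD.
apply: filterS x0 => t x0; rewrite minE le_min h0 x0 andTb !addE.
have x1t : 0 <= x1 t by exact: mul_indic_ge0.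
have x2t : 0 <= x2 t by exact: mul_indic_ge0.
have x3t : 0 <= x3 t by rewrite minE le_min x0.
have mx : Num.min (h t) (x t) <= x t by rewrite ge_min lexx orbT.
have mh : Num.min (h t) (x t) <= h t by rewrite ge_min lexx.
have [At|At] := pselect (A t); last first.
  have : x1 t = x t by exact: mul_indic_in.
  lra.
have [ct|ct] := ltP c (h t).
  have : x2 t = x t by exact: mul_indic_in.
  lra.
have : Num.min (h t) (x t) <= x3 t by rewrite minE le_min mx (le_trans mh).
lra.
Qed.

End function_norm.

(** * Un-convergence and convergence in measure *)

Section un_convergence.
Context d (T : measurableType d) (R : realType).
Context (mu : {measure set T -> \bar R}).

Lemma measure_restrict A (mA : measurable A) (y : L0 mu) (e : R) : 0 <= e ->
  mu [set t | e < `|L0_fun (L0_restrict mA y - 0) t|] =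
  mu (A `&` [set t | (e < abs_mfun (L0_fun y) t)%R]).
Proof.
move=> e0; have mf (f : {mfun T >-> R}) : measurable [set t | e < `|f t|].
  have -> : [set t | e < `|f t|] = [set t | e < abs_mfun f t].
    by apply/seteqP; split=> t; rewrite /mkset abs_mfunE.
  exact: measurable_mfun_gt.
apply: ae_eq_measure => //.
  by apply: measurableI => //; exact: measurable_mfun_gt.
rewrite subr0; have := L0_classK mu (L0_fun y * indic_mfun A mA).
apply: filterS => t; rewrite /setI /mkset abs_mfunE /L0_restrict => ->.
have [At|At] := pselect (A t).
  by rewrite mul_indic_in//; split=> [|[]].
by rewrite (mul_indic_out _ _ At) normr0 ltNge e0; split=> [|[]].
Qed.

Context (P : pred (L0 mu)) (X : banachSubspaceType P).

Lemma un_normE (y : L0 mu) (x : X) f : val x = L0_class mu f ->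
  `|insubd (0 : X) (vmeet (vabs (y - 0)) (val x))| =
  fnorm X (min_mfun (abs_mfun (L0_fun y)) f).
Proof.
move=> ->; rewrite subr0 -{1}(L0_funK y) vabs_class.
by congr `|insubd _ _|; exact: L0_meetE.
Qed.

End un_convergence.

Theorem theorem5p2 (d : measure_display) (T : measurableType d) (R : realType)
    (mu : {measure set T -> \bar R}) (hmu : sigma_finite [set: T] mu)
    (P : pred (L0 mu)) (X : banachSubspaceType P)
    (hX : is_banach_function_space X) (hXoc : order_continuous X)
    (dI : Order.disp_t) (I : preorderType dI) (hI : directed I)
    (y : I -> L0 mu) :
  un_cvg X y 0 <->
  (forall (A : set T) (mA : measurable A), (mu A < +oo)%E ->
     cvg_in_measure (fun i => L0_restrict mA (y i)) 0).
Proof.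
have PF := net_filter_proper hI.
have absy0 i t : 0 <= abs_mfun (L0_fun (y i)) t by rewrite abs_mfunE.
have minE f g t : min_mfun f g t = Num.min (f t) (g t) :> R by [].
split=> [un A mA Aoo c c0|inmeas x x0].
- apply/cvge0P => [i|e e0]; first exact: measure_ge0.
  have e2 : 0 < e / 2 by lra.
  have [f [f0 fX muf]] := almost_full_support hX mA Aoo e2.
  (* Capping [f] at [c] gives [x <= |y i|] where [|y i| > c]. *)
  have [x xE] : exists x : {mfun T >-> R}, forall t, x t = Num.min (f t) c.
    by exists (min_mfun f (cst c)).
  have x0 : forall t, 0 <= x t by move=> t; rewrite xE le_min f0 ltW.
  have xX : fdom P x.
    apply: (fdom_le hX) fX; apply: aeW => t.
    by rewrite x0 xE ge_min lexx.
  pose B := A `&` [set t | 0 < f t].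
  have mB : measurable B by apply: measurableI => //; exact: measurable_mfun_gt.
  have Boo : (mu B < +oo)%E.
    by apply: le_lt_trans Aoo; apply: le_measure; rewrite ?inE//; exact: subIsetl.
  have xB t : B t -> 0 < x t by move=> [_ ft]; rewrite xE lt_min ft.
  have [dl dl0 small] :=
    measure_abs_continuous hX hXoc mB Boo (aeW mu x0) xB xX e2.
  have [x' x'E] : exists x' : X, val x' = L0_class mu x.
    by exists (insubd 0 (L0_class mu x)); rewrite insubdK.
  have x'0 : 0 <= val x' by rewrite x'E; apply/L0_leP; exact: aeW.
  have /cvgr0_norm_lt/(_ dl dl0) := un x' x'0; apply: filterS => i.
  rewrite ger0_norm ?normr_ge0// (un_normE _ x'E) => ydl.
  rewrite (measure_restrict mA _ (ltW c0)).
  have mY : measurable [set t | c < abs_mfun (L0_fun (y i)) t].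
    exact: measurable_mfun_gt.
  have mC : measurable (B `&` [set t | c < abs_mfun (L0_fun (y i)) t]).
    exact: measurableI.
  have muC : (mu (B `&` [set t | (c < abs_mfun (L0_fun (y i)) t)%R])
      < (e / 2)%:E)%E.
    apply: (small _ mC (@subIsetl _ _ _)); apply: le_lt_trans ydl.
    have minX : fdom P (min_mfun (abs_mfun (L0_fun (y i))) x).
      apply: (fdom_le hX) xX; apply: aeW => t.
      by rewrite minE le_min ge_min absy0 x0 lexx orbT.
    apply: (fnorm_le hX) minX; apply: aeW => t; rewrite mul_indic_ge0// andTb.
    have [Ct|Ct] := pselect ((B `&` [set t | c < abs_mfun (L0_fun (y i)) t]) t).
      rewrite (mul_indic_in _ _ Ct) minE le_min lexx andbT xE ge_min.
      by case: Ct => _ /ltW ->; rewrite orbT.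
    by rewrite (mul_indic_out _ _ Ct) minE le_min absy0 x0.
  apply: (@le_lt_trans _ _ (mu (B `&` [set t | (c < abs_mfun (L0_fun (y i)) t)%R])
      + mu (A `&` [set t | (f t <= 0)%R]))%E); last first.
    by rewrite [e]splitr EFinD lteD.
  have mA0 : measurable (A `&` [set t | f t <= 0]).
    by apply: measurableI => //; exact: measurable_mfun_le.
  apply: le_trans (measureU2 mu mC mA0); apply: le_measure; rewrite ?inE.
  - exact: measurableI.
  - exact: measurableU.
  - move=> t [At ct]; have [ft|ft] := ltP 0 (f t); first by left.
    by right.
- pose f := L0_fun (val x).
  have xE : val x = L0_class mu f by rewrite L0_funK.
  have f0 : \forall t \ae mu, 0 <= f t by apply/(L0_leP mu 0); rewrite -xE.
  have fX : fdom P f by rewrite /fdom -xE; exact: valP.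
  apply/cvgr0Pnorm_lt => e e0; have e3 : 0 < e / 3 by lra.
  have [A [mA [Aoo NA]]] := fnorm_tail hX hXoc hmu f0 fX e3.
  have [c c0 Nc] := fnorm_min_cst hX hXoc f0 fX e3.
  have [dl dl0 small] := fnorm_abs_continuous hX hXoc f0 fX e3.
  have /cvge0P := inmeas A mA Aoo c c0.
  move=> /(_ (fun=> measure_ge0 _ _) dl dl0); apply: filterS => i.
  rewrite (measure_restrict mA _ (ltW c0)) => muY.
  rewrite ger0_norm ?normr_ge0// (un_normE _ xE).
  apply: le_lt_trans (fnorm_min_split hX mA (absy0 i) f0 fX (ltW c0)) _.
  have := small _ (measurableI _ _ mA (measurable_mfun_gt _ c)) muY.
  by lra.
Qed.
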